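(* For all $n,k,j\ge 1$ there is a bijection from the set of ordered trees with $n$ edges, $j$ internal nodes, and height at most $k$ onto the set of permutations $\sigma\in S_n(231)$ with $\mathrm{des}(\sigma)=j-1$ and $\mathrm{maxdrop}(\sigma)\le k-1$. Consequently, for $n\ge 1$ and $j,k\ge 0$, the number of $\sigma\in S_n(231)$ with $\mathrm{des}(\sigma)=j$ and $\mathrm{maxdrop}(\sigma)\le k$ equals the number of ordered trees with $n$ edges, $j+1$ internal nodes, and height at most $k+1$.
   Context: For a permutation $\sigma=\sigma_1\cdots\sigma_n$ of $[n]$, $\mathrm{des}(\sigma)$ is the number of $i\in[n-1]$ with $\sigma_i>\sigma_{i+1}$, and $\mathrm{maxdrop}(\sigma)=\max\{i-\sigma_i : i\in[n]\}$. $S_n(231)$ is the set of permutations of $[n]$ with no indices $a<b<c$ such that $\sigma_c<\sigma_a<\sigma_b$. An ordered tree is a rooted tree in which the children of each vertex are linearly ordered. The level of a vertex is its distance to the root; the height of the tree is the maximum level of a vertex. An internal node is a vertex with at least one child. *)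

(* Defs.v *)
From HB Require Import structures.
From mathcomp Require Import all_boot all_fingroup.

Set Implicit Arguments.
Unset Strict Implicit.
Unset Printing Implicit Defensive.

(* Permutations act on 'I_n = {0, ..., n-1} rather than [n] = {1, ..., n};
   pattern containment, descents and drops are unaffected by this shift. *)

Definition avoids231 n (s : 'S_n) : bool :=
  [forall a : 'I_n, forall b : 'I_n, forall c : 'I_n,
     (a < b) && (b < c) ==> ~~ ((s c < s a) && (s a < s b))].

Definition des n (s : 'S_n) : nat :=
  #|[set i : 'I_n | [exists i' : 'I_n, (val i' == i.+1) && (s i' < s i)]]|.

(* For n >= 1 the truncated subtraction gives the same maximum as the integer
   one: the drop at the position of the least value is never negative. *)
Definition maxdrop n (s : 'S_n) : nat := \max_(i < n) (i - s i).

Inductive otree := Node of seq otree.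

Definition children (t : otree) : seq otree := let: Node ts := t in ts.

(* One entry per vertex of t, in preorder: its level, offset by d, and the
   subtree hanging from it. *)
Fixpoint vertices_from (d : nat) (t : otree) : seq (nat * otree) :=
  let: Node ts := t in (d, t) :: flatten (map (vertices_from d.+1) ts).

Definition vertices : otree -> seq (nat * otree) := vertices_from 0.

Definition nedges (t : otree) : nat :=
  \sum_(v <- vertices t) size (children v.2).

Definition ninternal (t : otree) : nat :=
  count (fun v => 0 < size (children v.2)) (vertices t).

Definition height (t : otree) : nat := \max_(v <- vertices t) v.1.

Lemma otree_nested_ind (P : otree -> Prop) :
  (forall ts, foldr (fun t Q => P t /\ Q) True ts -> P (Node ts)) ->
  forall t, P t.
Proof.
move=> PN; fix IH 1 => -[ts]; apply: PN.
by elim: ts => //= t ts IHts; split.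
Qed.

Fixpoint otree_encode (t : otree) : GenTree.tree unit :=
  let: Node ts := t in GenTree.Node 0 (map otree_encode ts).

Fixpoint otree_decode (g : GenTree.tree unit) : otree :=
  if g is GenTree.Node _ gs then Node (map otree_decode gs) else Node [::].

Lemma otree_encodeK : cancel otree_encode otree_decode.
Proof.
elim/otree_nested_ind => ts IH /=; congr Node; rewrite -map_comp.
by elim: ts IH => //= t ts IHts [-> /IHts ->].
Qed.

HB.instance Definition _ := Countable.copy otree (can_type otree_encodeK).

Lemma sum_vertices d t :
  \sum_(v <- vertices_from d t) size (children v.2) = nedges t.
Proof.
suff eq_de e : \sum_(v <- vertices_from d t) size (children v.2)
             = \sum_(v <- vertices_from e t) size (children v.2) by exact: eq_de.
elim/otree_nested_ind: t d e => ts IH d e /=.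
rewrite !big_cons !big_flatten /= !big_map; congr (_ + _).
elim: ts IH => [|t ts IHts]; first by rewrite !big_nil.
by case=> IHt /IHts; rewrite !big_cons => ->; congr (_ + _); apply: IHt.
Qed.

Lemma nedges_Node ts : nedges (Node ts) = \sum_(t <- ts) (nedges t).+1.
Proof.
rewrite {1}/nedges big_cons /= big_flatten /= big_map.
under eq_bigr => t _ do rewrite sum_vertices.
by under [RHS]eq_bigr => t _ do rewrite -addn1; rewrite big_split /= sum1_size addnC.
Qed.

(* A list containing every forest ts with nedges (Node ts) <= m. *)
Fixpoint forests_upto (m : nat) : seq (seq otree) :=
  if m is m'.+1 then
    let fs := forests_upto m' in
    [::] :: [seq Node us :: ts | us <- fs, ts <- fs]
  else [:: [::]].

Lemma mem_forests_upto m ts : nedges (Node ts) <= m -> ts \in forests_upto m.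
Proof.
elim: m ts => [|m IH] [|[us] ts]; rewrite ?inE ?eqxx //.
  by rewrite nedges_Node big_cons.
rewrite nedges_Node big_cons -nedges_Node addSn ltnS => le_m.
apply/orP; right; apply: allpairs_f; apply: IH; apply: leq_trans le_m.
  exact: leq_addr.
exact: leq_addl.
Qed.

(* The ordered trees with n edges, as a finite type. *)
Record otree_of (n : nat) :=
  OtreeOf { otree_val :> otree; _ : nedges otree_val == n }.

HB.instance Definition _ n := [isSub for @otree_val n].
HB.instance Definition _ n := [Countable of otree_of n by <:].

Definition otree_of_enum n : seq (otree_of n) :=
  undup (pmap insub (map Node (forests_upto n))).

Lemma otree_of_enumP n : Finite.axiom (otree_of_enum n).
Proof.
apply: Finite.uniq_enumP => [|t]; first exact: undup_uniq.
rewrite mem_undup mem_pmap_sub inE /=; case: t => -[ts] /= /eqP def_n.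
by rewrite mem_map ?mem_forests_upto ?def_n // => us vs [].
Qed.

HB.instance Definition _ n := isFinite.Build (otree_of n) (@otree_of_enumP n).

Definition trees (n j k : nat) : {set otree_of n} :=
  [set t : otree_of n | (ninternal t == j) && (height t <= k)].

Definition perms231 (n d m : nat) : {set 'S_n} :=
  [set s : 'S_n | [&& avoids231 s, des s == d & maxdrop s <= m]].

(* Main.v *)
Require Import Defs.
From mathcomp Require Import all_boot all_fingroup.
From mathcomp Require Import zify.

(** Label the non-root vertices of an ordered tree by their postorder ranks and
    read the labels in preorder.  If the first child of the root carries a
    subtree with m edges, the resulting word is m, followed by the word of that
    subtree, followed by the word of the remaining tree shifted by m + 1.
    Conversely, a 231-avoiding word starting with m lists all values below m
    before all values above m, so it splits uniquely in this way.  A label is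
    followed by a smaller one exactly when its vertex is internal, and the drop
    at a vertex of level l with r proper descendants is l - 1 - r, which is
    maximal at a deepest leaf. *)

Set Implicit Arguments.
Unset Strict Implicit.
Unset Printing Implicit Defensive.

(** * Tree statistics under removal of the first subtree of the root *)

Lemma otree_binary_ind (P : otree -> Prop) :
    P (Node [::]) ->
    (forall u ts, P u -> P (Node ts) -> P (Node (u :: ts))) ->
  forall t, P t.
Proof.
move=> P0 PS; elim/otree_nested_ind => ts; elim: ts => [|u ts IHts] //=.
by case=> Pu /IHts; apply: PS.
Qed.

Lemma nedges_leaf : nedges (Node [::]) = 0.
Proof. by rewrite nedges_Node big_nil. Qed.

Lemma nedges_cons u ts :
  nedges (Node (u :: ts)) = (nedges u).+1 + nedges (Node ts).
Proof. by rewrite !nedges_Node big_cons. Qed.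

Lemma ninternal_from d t :
  count (fun v => 0 < size (children v.2)) (vertices_from d t) = ninternal t.
Proof.
suff eq_de e : count (fun v => 0 < size (children v.2)) (vertices_from d t)
             = count (fun v => 0 < size (children v.2)) (vertices_from e t).
  exact: eq_de.
elim/otree_nested_ind: t d e => ts IH d e /=; congr (_ + _).
rewrite !count_flatten -!map_comp; congr sumn.
elim: ts IH => //= t ts IHts [IHt /IHts ->].
by rewrite (IHt d.+1 e.+1).
Qed.

(** The root is internal here. For nonempty [ts] it is already counted in [ninternal (Node ts)],
    which is then positive; for empty [ts] that count is 0 and [maxn 1] supplies the root. *)
Lemma ninternal_cons u ts :
  ninternal (Node (u :: ts)) = ninternal u + maxn 1 (ninternal (Node ts)).
Proof.
rewrite {1}/ninternal /= count_cat ninternal_from addnCA; congr (_ + _).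
by rewrite /ninternal; case: ts => [|v ts] //=; rewrite (maxn_idPr _).
Qed.

Lemma height_from d t :
  \max_(v <- vertices_from d t) v.1 = d + height t.
Proof.
suff eq_de e : (\max_(v <- vertices_from (d + e) t) v.1
             = d + \max_(v <- vertices_from e t) v.1)%N.
  by rewrite -[d in LHS]addn0 eq_de.
elim/otree_nested_ind: t d e => ts IH d e /=.
rewrite !big_cons !big_flatten /= !big_map addn_maxr.
elim: ts IH => [|t ts IHts]; first by rewrite !big_nil; lia.
case=> IHt /IHts {}IHts; rewrite !big_cons; have := IHt d e.+1.
by rewrite addnS => ->; lia.
Qed.

Lemma height_cons u ts :
  height (Node (u :: ts)) = maxn (height u).+1 (height (Node ts)).
Proof.
have heightE vs :
    height (Node vs) = \max_(v <- flatten (map (vertices_from 1) vs)) v.1.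
  by rewrite /height /= big_cons max0n.
by rewrite !heightE /= big_cat /= height_from.
Qed.

(** * The word of a tree *)

Fixpoint word (t : otree) : seq nat :=
  let: Node ts := t in
  foldr (fun u w => nedges u :: word u ++ map (addn (nedges u).+1) w) [::] ts.

Arguments word : simpl never.

Lemma word_cons u ts :
  word (Node (u :: ts))
  = nedges u :: word u ++ map (addn (nedges u).+1) (word (Node ts)).
Proof. by []. Qed.

Lemma size_word t : size (word t) = nedges t.
Proof.
elim/otree_binary_ind: t => [|u ts IHu IHts]; first by rewrite nedges_leaf.
by rewrite word_cons /= size_cat size_map IHu IHts nedges_cons.
Qed.

Lemma perm_word t : perm_eq (word t) (iota 0 (nedges t)).
Proof.
elim/otree_binary_ind: t => [|u ts IHu IHts]; first by rewrite nedges_leaf.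
rewrite word_cons nedges_cons iotaD -addn1 iotaD /= add0n -catA /= -cat1s.
(* The leading label moves behind the block of labels smaller than it, where it stands in [iota]. *)
rewrite perm_catCA perm_cat //= perm_cons addn1.
by rewrite -[X in iota X _]addn0 iotaDl perm_map.
Qed.

Lemma ltn_word t x : x \in word t -> x < nedges t.
Proof. by rewrite (perm_mem (perm_word t)) mem_iota. Qed.

(** The first letter is the length of the first block, so it determines where to cut the rest of the
    word. *)
Lemma word_inj : injective word.
Proof.
elim/otree_binary_ind => [|u ts IHu IHts] [[|u' ts']] //.
rewrite !word_cons => -[eq_m /eqP].
rewrite eq_m eqseq_cat ?size_word // => /andP[/eqP/IHu <- /eqP].
by move/(inj_map (@addnI _))/(IHts (Node ts')) => [[<-]].
Qed.

(** * 231-avoiding words are exactly the words of trees *)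

Fixpoint word_avoids231 (w : seq nat) : bool :=
  if w is x :: w' then
    pairwise (fun y z => ~~ (z < x < y)) w' && word_avoids231 w'
  else true.

Lemma word_avoids231_catlr s1 s2 :
  word_avoids231 (s1 ++ s2) -> word_avoids231 s1 /\ word_avoids231 s2.
Proof.
elim: s1 => //= x s1 IHs /andP[]; rewrite pairwise_cat.
by case/and3P=> _ -> _ /IHs.
Qed.

(** No occurrence of 231 straddles the cut: its last letter is its least, so if that letter lies in
    [s2], the two larger ones cannot lie in [s1]. *)
Lemma word_avoids231_cat s1 s2 :
    {in s1 & s2, forall x y, x < y} ->
  word_avoids231 s1 -> word_avoids231 s2 -> word_avoids231 (s1 ++ s2).
Proof.
move=> + + av2; elim: s1 => //= x s1 IHs lt12 /andP[px av1].
have lt_x y : y \in s2 -> x < y by apply: lt12; rewrite mem_head.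
rewrite IHs // => [|y z ys zs]; last by apply: lt12; rewrite // inE ys orbT.
rewrite andbT pairwise_cat px; apply/andP; split.
  by apply/allrelP => y z _ /lt_x; lia.
have: all (fun z => x < z) s2 by apply/allP.
elim: s2 {lt12 av2 lt_x IHs} => //= y s2 IHs /andP[lt_xy lt_x].
rewrite IHs // andbT; apply/allP => z /(allP lt_x); lia.
Qed.

Lemma word_avoids231_shift k w :
  word_avoids231 (map (addn k) w) = word_avoids231 w.
Proof.
elim: w => //= x w ->; congr (_ && _); rewrite pairwise_map.
by apply: eq_pairwise => y z /=; rewrite !ltn_add2l.
Qed.

Lemma word_avoids t : word_avoids231 (word t).
Proof.
elim/otree_binary_ind: t => [//|u ts IHu IHts]; rewrite word_cons /=.
apply/andP; split; last first.
  apply: word_avoids231_cat; rewrite ?word_avoids231_shift // => x y.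
  by move=> /ltn_word lt_x /mapP[z _ ->]; lia.
rewrite pairwise_cat; apply/and3P; split.
- by apply/allrelP => y z /ltn_word lt_y _; lia.
- have: all (fun y => y < nedges u) (word u) by apply/allP => y /ltn_word.
  elim: (word u) => //= y w IHw /andP[lt_y /IHw ->]; rewrite andbT.
  by apply/allP => z _; lia.
- rewrite pairwise_map; elim: (word (Node ts)) => //= y w ->; rewrite andbT.
  by apply/allP => z _ /=; lia.
Qed.

(** Once a letter above [x] occurs, no later letter may lie below [x]. *)
Lemma pairwise_split x w :
    x \notin w -> pairwise (fun y z => ~~ (z < x < y)) w ->
  w = [seq y <- w | y < x] ++ [seq y <- w | x < y].
Proof.
elim: w => //= y w IHw; rewrite inE negb_or => /andP[ne_xy xw] /andP[all_y pw].
case: ltngtP ne_xy => // [lt_yx _|lt_xy _]; first by rewrite /= -IHw.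
have ge_w: all (fun z => x < z) w.
  apply/allP => z zw; have := allP all_y z zw.
  have: x != z by apply: contraNneq xw => ->.
  lia.
rewrite (all_filterP ge_w); suff ->: [seq z <- w | z < x] = [::] by [].
apply/eqP; rewrite -[_ == _]negbK -has_filter; apply/hasPn => z /(allP ge_w).
lia.
Qed.

(** Strong induction on the length. The base [k] varies because the letters above [x] fill an
    interval starting at [x.+1]. *)
Lemma word_surj n k w :
    perm_eq w (iota k n) -> word_avoids231 w ->
  exists2 t, nedges t = n & w = map (addn k) (word t).
Proof.
have [N] := ubnP n; elim: N => // N IHN in n k w *.
case: w => [|x w] lt_nN perm_w.
  by exists (Node [::]); rewrite // nedges_leaf -[n](size_iota k) -(perm_size perm_w).
move: (perm_size perm_w) (perm_mem perm_w) (perm_uniq perm_w).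
rewrite iota_uniq size_iota /= => def_n mem_w /andP[xw uniq_w] /andP[px av_w].
have mem_w' y : (y \in w) = (y != x) && (k <= y < k + n).
  have := mem_w y; rewrite inE mem_iota; case: eqP => [->|] //=.
  by rewrite (negPf xw).
have: x \in iota k n by rewrite -mem_w mem_head.
rewrite mem_iota => xn.
have def_w := pairwise_split xw px; move: av_w; rewrite def_w.
case/word_avoids231_catlr => avA avB.
(* The letters below [x] are exactly those of the interval from [k] to [x - 1], hence [x - k] in
   number. *)
have [||u nu def_A] := IHN (x - k) k _ _ _ avA; first by lia.
  apply: uniq_perm; rewrite ?filter_uniq ?iota_uniq // => y.
  by rewrite mem_filter mem_w' mem_iota; lia.
have [||[ts] nts def_B] := IHN (n - (x - k).+1) x.+1 _ _ _ avB; first by lia.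
  apply: uniq_perm; rewrite ?filter_uniq ?iota_uniq // => y.
  by rewrite mem_filter mem_w' mem_iota; lia.
exists (Node (u :: ts)); first by rewrite nedges_cons nu nts; lia.
rewrite word_cons /= map_cat -map_comp nu def_A def_B; congr (_ :: _ ++ _).
  by lia.
by apply: eq_map => y /=; lia.
Qed.

(** * Descents and internal nodes *)

(* [word_des 0 w] is the number of descents of [w], since nothing is below 0. *)
Definition word_des (x : nat) (w : seq nat) : nat :=
  sumn (pairmap (fun y z => (z < y) : nat) x w).

(** Isolates the comparison at a junction, so that descents of a concatenation can be added block by
    block. *)
Lemma word_desE x w :
  word_des x w = (~~ nilp w && (head 0 w < x)) + word_des 0 w.
Proof. by case: w. Qed.

Lemma word_des_shift k w : word_des 0 (map (addn k) w) = word_des 0 w.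
Proof.
case: w => [|x w] //; rewrite /word_des /= !add0n.
elim: w x => //= y w IHw x; rewrite ltn_add2l; congr (_ + _); exact: IHw.
Qed.

Lemma ninternal_gt0 t : (0 < ninternal t) = (0 < nedges t).
Proof.
elim/otree_binary_ind: t => [|u ts _ _]; first by rewrite nedges_leaf.
by rewrite ninternal_cons nedges_cons; lia.
Qed.

Lemma word_des_word t : word_des 0 (word t) = (ninternal t).-1.
Proof.
elim/otree_binary_ind: t => [//|u ts IHu IHts].
rewrite ninternal_cons word_cons /word_des /= pairmap_cat sumn_cat.
rewrite -!/(word_des _ _) word_desE [word_des (last _ _) _]word_desE.
rewrite IHu word_des_shift IHts.
(* No descent enters the shifted block: its letters exceed [nedges u], and all earlier letters are
   at most that. *)
have -> : ~~ nilp (map (addn (nedges u).+1) (word (Node ts))) &&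
    (head 0 (map (addn (nedges u).+1) (word (Node ts))) < last (nedges u) (word u))
    = false.
  have: last (nedges u) (word u) <= nedges u.
    have := mem_last (nedges u) (word u); rewrite inE.
    by case/orP=> [/eqP->|/ltn_word/ltnW].
  by case: (word (Node ts)) => //= y w; lia.
(* When [u] has an edge, the descent from the first letter into [word u] makes up for the
   predecessor in [(ninternal u).-1]. *)
rewrite /nilp size_word -lt0n.
have := ninternal_gt0 u.
have: 0 < nedges u -> head 0 (word u) < nedges u.
  rewrite -[in X in X -> _]size_word; case def_u: (word u) => [|y w] //= _.
  by rewrite ltn_word // def_u mem_head.
lia.
Qed.

(** * Drops and height *)

Definition word_maxdrop (d : nat) (w : seq nat) : nat :=
  \max_(i < size w) (d + i - nth 0 w i).

Lemma word_maxdrop_cons d x w :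
  word_maxdrop d (x :: w) = maxn (d - x) (word_maxdrop d.+1 w).
Proof.
rewrite /word_maxdrop /= big_ord_recl addn0 /=; congr maxn.
by apply: eq_bigr => i _; rewrite /bump /= add1n addnS.
Qed.

Lemma word_maxdrop_cat d s1 s2 :
  word_maxdrop d (s1 ++ s2)
  = maxn (word_maxdrop d s1) (word_maxdrop (d + size s1) s2).
Proof.
elim: s1 d => [|x s1 IHs] d; first by rewrite addn0 {2}/word_maxdrop big_ord0 max0n.
by rewrite /= !word_maxdrop_cons IHs maxnA addSnnS.
Qed.

Lemma word_maxdrop_shift d k w :
  word_maxdrop (d + k) (map (addn k) w) = word_maxdrop d w.
Proof.
rewrite /word_maxdrop size_map; apply: eq_bigr => i _.
by rewrite (nth_map 0) //; lia.
Qed.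

Lemma height_gt0 t : (0 < height t) = (0 < nedges t).
Proof.
case: t => -[|u ts]; last by rewrite height_cons nedges_cons; lia.
by rewrite nedges_leaf /height /= big_cons big_nil.
Qed.

(** The block [word u] sits one position later with unshifted values, which matches levels rising by
    one below the root; the last block has positions and values shifted equally. The empty word is
    separate because its maximum is 0 for every [d]. *)
Lemma word_maxdrop_word d t :
  word_maxdrop d (word t) = if nedges t == 0 then 0 else (d + height t).-1.
Proof.
elim/otree_binary_ind: t d => [|u ts IHu IHts] d.
  by rewrite nedges_leaf /word_maxdrop big_ord0.
rewrite word_cons word_maxdrop_cons word_maxdrop_cat addSnnS size_word.
rewrite word_maxdrop_shift IHu IHts nedges_cons height_cons.
have := height_gt0 u; have := height_gt0 (Node ts).
by do 3!case: eqP => ?; lia.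
Qed.

(** * Permutations in one-line notation *)

Definition perm_to_word n (s : 'S_n) : seq nat := [seq val (s i) | i : 'I_n].

Lemma size_perm_to_word n (s : 'S_n) : size (perm_to_word s) = n.
Proof. by rewrite size_map size_enum_ord. Qed.

Lemma nth_perm_to_word n (s : 'S_n) (i : 'I_n) : nth 0 (perm_to_word s) i = s i.
Proof. by rewrite (nth_map i) ?size_enum_ord // nth_ord_enum. Qed.

Lemma perm_to_word_inj n : injective (@perm_to_word n).
Proof.
move=> s1 s2 eq_s; apply/permP => i; apply: val_inj.
by rewrite /= -!nth_perm_to_word eq_s.
Qed.

Lemma perm_to_wordP n w :
  reflect (exists s : 'S_n, perm_to_word s = w) (perm_eq w (iota 0 n)).
Proof.
have wordE (s : 'S_n) :
    perm_to_word s = [tuple tnth (iota_tuple n 0) (s i) | i < n].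
  rewrite /perm_to_word /=; apply: eq_map => i.
  by rewrite (tnth_nth 0) /= nth_iota.
by apply: (iffP (@tuple_permP _ n w (iota_tuple n 0))) => -[s def_w];
   exists s; rewrite -?wordE def_w ?wordE.
Qed.

Lemma word_avoids231P w :
  reflect (forall a b c, a < b < c -> c < size w ->
             ~~ (nth 0 w c < nth 0 w a < nth 0 w b))
          (word_avoids231 w).
Proof.
elim: w => [|x w IHw] /=; first by left.
apply: (iffP andP) => [[/(pairwiseP 0) px /IHw av_w] | av_w].
  case=> [|a] [|b] [|c] /andP[lt_ab lt_bc] lt_c //=.
    by apply: px; rewrite ?inE; lia.
  by apply: av_w => //; apply/andP.
split; last by apply/IHw => a b c; apply: (av_w a.+1 b.+1 c.+1).
apply/(pairwiseP 0) => b c; rewrite !inE => lt_b lt_c lt_bc.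
exact: (av_w 0 b.+1 c.+1).
Qed.

Lemma avoids231_perm_to_word n (s : 'S_n) :
  avoids231 s = word_avoids231 (perm_to_word s).
Proof.
apply/idP/word_avoids231P => [av_s a b c /andP[lt_ab lt_bc] | av_s].
  rewrite size_perm_to_word => lt_cn.
  have lt_bn := ltn_trans lt_bc lt_cn; have lt_an := ltn_trans lt_ab lt_bn.
  move/forallP/(_ (Ordinal lt_an))/forallP/(_ (Ordinal lt_bn)): av_s.
  move/forallP/(_ (Ordinal lt_cn)); rewrite lt_ab lt_bc /=.
  by rewrite -!nth_perm_to_word.
apply/forallP => a; apply/forallP => b; apply/forallP => c; apply/implyP => lt_abc.
by rewrite -!nth_perm_to_word av_s // size_perm_to_word.
Qed.

Lemma des_perm_to_word n (s : 'S_n) : des s = word_des 0 (perm_to_word s).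
Proof.
rewrite /des /word_des -sum1dep_card big_mkcond sumnE.
rewrite (big_nth 0) size_pairmap size_perm_to_word big_mkord.
case: n s => [|n] s; first by rewrite !big_ord0.
(* [des] indexes a descent by its left end and [word_des] by its right end. The last term on one
   side and the first on the other vanish, which aligns the indices. *)
rewrite big_ord_recr big_ord_recl /=.
rewrite [X in _ + X](_ : _ = 0); last first.
  by case: existsP => // -[i /andP[/eqP/= def_i _]]; have := ltn_ord i; lia.
rewrite addn0 [X in X + _](_ : _ = 0) ?add0n; last first.
  by rewrite (nth_pairmap 0) ?size_perm_to_word.
apply: eq_bigr => i _; rewrite (nth_pairmap 0) ?size_perm_to_word ?(ltn_ord (lift ord0 i)) //.
have -> : nth 0 (0 :: perm_to_word s) (lift ord0 i) = s (widen_ord (leqnSn n) i).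
  exact: (nth_perm_to_word s (widen_ord (leqnSn n) i)).
rewrite (nth_perm_to_word s (lift ord0 i)).
set b1 := [exists _, _]; set b2 := _ < _.
suff ->: b1 = b2 by case: b2.
apply/existsP/idP => [[i' /andP[/eqP def_i']]|lt_s].
  by rewrite (_ : i' = lift ord0 i) //; apply: val_inj; rewrite /= def_i'.
by exists (lift ord0 i); rewrite /= eqxx.
Qed.

Lemma maxdrop_perm_to_word n (s : 'S_n) :
  maxdrop s = word_maxdrop 0 (perm_to_word s).
Proof.
rewrite /maxdrop /word_maxdrop size_perm_to_word.
by apply: eq_bigr => i _; rewrite nth_perm_to_word.
Qed.

(** * The bijection from trees to permutations *)

Definition tree_perm n (t : otree_of n) : 'S_n :=
  odflt 1%g [pick s | perm_to_word s == word t].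

Lemma tree_permK n (t : otree_of n) : perm_to_word (tree_perm t) = word t.
Proof.
rewrite /tree_perm; case: pickP => [s /eqP // | no_s].
have [|s def_s] := @perm_to_wordP n (word t) _.
  by rewrite -{2}(eqP (valP t)) perm_word.
by have := no_s s; rewrite def_s eqxx.
Qed.

Lemma tree_perm_inj n : injective (@tree_perm n).
Proof.
move=> t1 t2 eq_t; apply/val_inj/word_inj.
by rewrite /= -!tree_permK eq_t.
Qed.

Lemma tree_perm_surj n (s : 'S_n) :
  avoids231 s -> exists t : otree_of n, tree_perm t = s.
Proof.
rewrite avoids231_perm_to_word.
have /word_surj surj: perm_eq (perm_to_word s) (iota 0 n).
  by apply/perm_to_wordP; exists s.
case/surj => t /eqP nt def_s; exists (OtreeOf nt).
by apply: perm_to_word_inj; rewrite tree_permK def_s /= map_id.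
Qed.

Lemma mem_tree_perm n j k (t : otree_of n) : 1 <= n -> 1 <= k -> 1 <= j ->
  (tree_perm t \in perms231 n (j - 1) (k - 1)) = (t \in trees n j k).
Proof.
move=> n_gt0 k_gt0 j_gt0; have /eqP nt := valP t; rewrite /= in nt.
rewrite !inE avoids231_perm_to_word des_perm_to_word maxdrop_perm_to_word.
rewrite tree_permK word_avoids word_des_word word_maxdrop_word add0n andTb.
(* Both statistics are positive as [n] is, so comparing their predecessors with [j - 1] and [k - 1]
   loses nothing. *)
have := height_gt0 t; have := ninternal_gt0 t.
by rewrite nt [n == 0]gtn_eqF //; lia.
Qed.

Lemma imset_tree_perm n j k : 1 <= n -> 1 <= k -> 1 <= j ->
  @tree_perm n @: trees n j k = perms231 n (j - 1) (k - 1).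
Proof.
move=> n_gt0 k_gt0 j_gt0; apply/setP => s; apply/imsetP/idP => [[t t_in ->]|].
  by rewrite mem_tree_perm.
move=> s_in; have := s_in; rewrite inE => /andP[/tree_perm_surj[t def_s] _].
by exists t; rewrite // -mem_tree_perm // def_s.
Qed.

Theorem theorem6 :
  (forall n k j : nat, 1 <= n -> 1 <= k -> 1 <= j ->
     exists f : otree_of n -> 'S_n,
       {in trees n j k &, injective f} /\
       f @: trees n j k = perms231 n (j - 1) (k - 1)) /\
  (forall n j k : nat, 1 <= n ->
     #|perms231 n j k| = #|trees n (j + 1) (k + 1)|).
Proof.
split=> [n k j n_gt0 k_gt0 j_gt0 | n j k n_gt0].
  exists (@tree_perm n); split; last exact: imset_tree_perm.
  by move=> t1 t2 _ _; apply: tree_perm_inj.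
have := imset_tree_perm n_gt0 (leq_addl k 1) (leq_addl j 1).
by rewrite !addnK => <-; rewrite card_imset //; apply: tree_perm_inj.
Qed.
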